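(* Let $X$ be a space and let $\mathscr{I}$ be an ideal in an upper semi-lattice $(\mathscr{L},\subseteq)$, where $\mathscr{L}\subseteq\mathscr{P}(X)$. Then $C^{\mathscr I}_0(X)$ is a closed ideal in $C_b(X)$. Furthermore, \[C^{\mathscr I}_{00}(X)\subseteq C^{\mathscr I}_0(X).\]
   Context: A space is a topological space and $\mathscr{P}(X)$ is the power set of $X$. $C_b(X)$ is the normed algebra of continuous bounded $f:X\to\mathbb{R}$ with pointwise operations and the supremum norm; $\mathrm{coz}(f)=X\setminus f^{-1}(0)$ and $\mathrm{supp}(f)=\mathrm{cl}_X\mathrm{coz}(f)$. An upper semi-lattice is a partially ordered set in which any two elements $A,B$ have a least upper bound $A\vee B$. For $\mathscr{L}\subseteq\mathscr{P}(X)$ ordered by inclusion, $A\vee B$ is computed in $\mathscr{L}$ and need not equal $A\cup B$. An ideal $\mathscr{I}$ in $(\mathscr{L},\subseteq)$ is a non-empty subset of $\mathscr{L}$ such that $A\vee B\in\mathscr{I}$ whenever $A,B\in\mathscr{I}$, and $T\in\mathscr{I}$ whenever $T\in\mathscr{L}$ and $T\subseteq A$ for some $A\in\mathscr{I}$. Elements of $\mathscr{I}$ are called null. A neighborhood of a set $A$ in $X$ is a set $U\subseteq X$ with $A\subseteq\mathrm{int}_XU$. $C^{\mathscr I}_{00}(X)=\{f\in C_b(X):\mathrm{supp}(f)\text{ has a null neighborhood in }X\}$. $C^{\mathscr I}_0(X)=\{f\in C_b(X):|f|^{-1}([1/n,\infty))\text{ has a null neighborhood in }X\text{ for each positive integer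 }n\}$. *)

(* Defs.v *)
From HB Require Import structures.
From mathcomp Require Import all_boot all_order all_algebra.
From mathcomp Require Import boolp classical_sets functions reals.
From mathcomp Require Import topology normedtype.

Set Implicit Arguments.
Unset Strict Implicit.
Unset Printing Implicit Defensive.

Import Order.TTheory GRing.Theory Num.Theory.
Import numFieldNormedType.Exports.

Local Open Scope classical_set_scope.
Local Open Scope ring_scope.

Definition bcontinuous (X : topologicalType) (R : realType) :
  {pred (X -> R)} :=
  mem [set f : X -> R | continuous f /\ bounded_fun f].

Arguments bcontinuous : clear implicits.

Record Cb (X : topologicalType) (R : realType) := MkCb {
  Cb_fun :> X -> R;
  Cb_fun_subproof : Cb_fun \in bcontinuous X R
}.

HB.instance Definition _ (X : topologicalType) (R : realType) :=
  [isSub for @Cb_fun X R].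
HB.instance Definition _ (X : topologicalType) (R : realType) :=
  [Choice of Cb X R by <:].

Section Cb_algebra.
Context (X : topologicalType) (R : realType).

Lemma bcontinuousP (f : X -> R) :
  f \in bcontinuous X R <->
  continuous f /\ exists M : R, forall x, `|f x| <= M.
Proof.
rewrite inE /=; split=> -[cf bf]; split=> //.
  by have [M _ fM] := pinfty_ex_gt0 bf; exists M => x; exact: fM.
case: bf => M fM; rewrite /bounded_near; near=> N => x _.
apply: le_trans (fM x) _.
by near: N; apply: nbhs_pinfty_ge; exact: num_real.
Unshelve. all: by end_near. Qed.

Lemma bcontinuous_subring_closed : subring_closed (bcontinuous X R).
Proof.
split.
- apply/bcontinuousP; split; first by move=> x; exact: cvg_cst.
  by exists 1 => x; rewrite normr1.
- move=> f g /bcontinuousP[cf [M fM]] /bcontinuousP[cg [N gN]].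
  apply/bcontinuousP; split; first by move=> x; apply: cvgB; [exact: cf|exact: cg].
  by exists (M + N) => x; rewrite (le_trans (ler_normB _ _))// lerD.
- move=> f g /bcontinuousP[cf [M fM]] /bcontinuousP[cg [N gN]].
  apply/bcontinuousP; split; first by move=> x; apply: cvgM; [exact: cf|exact: cg].
  by exists (M * N) => x; rewrite normrM ler_pM.
Qed.

Lemma bcontinuous_scaler_closed : GRing.scaler_closed (bcontinuous X R).
Proof.
move=> a f /bcontinuousP[cf [M fM]]; apply/bcontinuousP; split.
  by move=> x; apply: cvgZr; exact: cf.
by exists (`|a| * M) => x; rewrite normrZ ler_wpM2l.
Qed.

HB.instance Definition _ :=
  GRing.isSubringClosed.Build (X -> R) (bcontinuous X R)
    bcontinuous_subring_closed.
HB.instance Definition _ :=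
  GRing.isScaleClosed.Build R (X -> R) (bcontinuous X R)
    bcontinuous_scaler_closed.
HB.instance Definition _ :=
  GRing.SubChoice_isSubComPzRing.Build (X -> R) (bcontinuous X R) (Cb X R)
    bcontinuous_subring_closed.
HB.instance Definition _ := [SubZmodule_isSubLmodule of Cb X R by <:].

Lemma Cb_scalerAl (a : R) (f g : Cb X R) : a *: (f * g) = (a *: f) * g.
Proof. by apply/val_inj/funext => x; exact: mulrA. Qed.

(* [sup set0 = 0], so the norm is [0] on the trivial algebra over an empty
   space. *)
Definition supnorm (f : Cb X R) : R := sup (range (fun x => `|f x|)).

Lemma supnorm_ge (f : Cb X R) (x : X) : `|f x| <= supnorm f.
Proof.
have /bcontinuousP[_ [M fM]] := Cb_fun_subproof f.
by apply: ub_le_sup; [exists M => _ [y _ <-]|exists x].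
Qed.

Lemma supnorm_le (f : Cb X R) (M : R) :
  0 <= M -> (forall x, `|f x| <= M) -> supnorm f <= M.
Proof.
move=> M0 fM; rewrite /supnorm.
have [->|/set0P fn0] := eqVneq (range (fun x => `|f x|)) set0; first by rewrite sup0.
by apply: ge_sup => // _ [x _ <-].
Qed.

Lemma supnorm_ge0 (f : Cb X R) : 0 <= supnorm f.
Proof.
rewrite /supnorm; have [->|/set0P[_ [x _ _]]] :=
  eqVneq (range (fun x => `|f x|)) set0; first by rewrite sup0.
exact: le_trans (normr_ge0 _) (supnorm_ge f x).
Qed.

Lemma supnormD (f g : Cb X R) : supnorm (f + g) <= supnorm f + supnorm g.
Proof.
apply: supnorm_le => [|x]; first by rewrite addr_ge0 ?supnorm_ge0.
by rewrite (le_trans (ler_normD _ _))// lerD ?supnorm_ge.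
Qed.

Lemma supnormZ (a : R) (f : Cb X R) : supnorm (a *: f) = `|a| * supnorm f.
Proof.
have leZ b h : supnorm (b *: h) <= `|b| * supnorm h.
  apply: supnorm_le => [|x]; first by rewrite mulr_ge0 ?supnorm_ge0.
  by rewrite normrZ ler_wpM2l ?supnorm_ge.
apply/eqP; rewrite eq_le leZ/=; have [->|a0] := eqVneq a 0.
  by rewrite normr0 mul0r supnorm_ge0.
by rewrite -ler_pdivlMl ?normr_gt0// -normfV (le_trans _ (leZ _ _))//
  scalerA mulVf// scale1r.
Qed.

Lemma supnorm_eq0 (f : Cb X R) : supnorm f = 0 -> f = 0.
Proof.
move=> f0; apply/val_inj/funext => x; apply/eqP.
by rewrite -normr_le0 -f0; exact: supnorm_ge.
Qed.

HB.instance Definition _ :=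
  Lmodule_isNormed.Build R (Cb X R) supnormD supnormZ supnorm_eq0.

Lemma Cb_normM (f g : Cb X R) : `|f * g| <= `|f| * `|g|.
Proof.
apply: supnorm_le => [|x]; first by rewrite mulr_ge0.
by rewrite normrM ler_pM//; exact: supnorm_ge.
Qed.

(* An ideal need not be proper. *)
Definition is_ideal (J : set (Cb X R)) : Prop :=
  [/\ J 0,
      forall f g, J f -> J g -> J (f + g),
      forall (a : R) f, J f -> J (a *: f)
    & forall f g, J g -> J (f * g)].

Definition coz (f : Cb X R) : set X := ~` (f @^-1` [set 0]).

Definition supp (f : Cb X R) : set X := closure (coz f).

End Cb_algebra.

(* The least upper bound is taken in [L], not in the full power set. *)
Definition is_join (X : Type) (L : set (set X)) (A B C : set X) : Prop :=
  [/\ L C, A `<=` C, B `<=` C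
    & forall D, L D -> A `<=` D -> B `<=` D -> C `<=` D].

Definition upper_semilattice (X : Type) (L : set (set X)) : Prop :=
  forall A B, L A -> L B -> exists C, is_join L A B C.

Definition semilattice_ideal (X : Type) (L I : set (set X)) : Prop :=
  [/\ I !=set0,
      I `<=` L,
      forall A B C, I A -> I B -> is_join L A B C -> I C
    & forall T A, L T -> I A -> T `<=` A -> I T].

Section vanishing.
Context (X : topologicalType) (R : realType).

Definition has_null_neighborhood (I : set (set X)) (A : set X) : Prop :=
  exists2 U, I U & A `<=` interior U.

Definition C00 (I : set (set X)) : set (Cb X R) :=
  [set f | has_null_neighborhood I (supp f)].

Definition C0 (I : set (set X)) : set (Cb X R) :=
  [set f | forall n : nat, (0 < n)%N ->
    has_null_neighborhood I
      ((fun x => `|f x|) @^-1` `[n%:R^-1, +oo[%classic)].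

End vanishing.

Arguments C00 {X} R I.
Arguments C0 {X} R I.

(* Main.v *)
Require Import Defs.
From mathcomp Require Import all_boot all_order all_algebra.
From mathcomp Require Import boolp classical_sets functions reals.
From mathcomp Require Import topology normedtype.
Import Order.TTheory GRing.Theory Num.Theory.
Import numFieldNormedType.Exports.
Local Open Scope classical_set_scope.
Local Open Scope ring_scope.

(** The sets having a null neighborhood form an ideal of the full power set of
    the space: they contain the empty set, they pass to subsets, and they are
    closed under binary union because a join in the semi-lattice, although it
    may be larger than the union, still contains both of its arguments
    ([has_null_neighborhood0], [has_null_neighborhoodS],
    [has_null_neighborhoodU]).

    By the Archimedean property, membership in [C0 R I] means that every
    superlevel set [[set x | e <= `|f x|]] with [0 < e] belongs to this ideal
    ([C0P]), which frees the arguments from the levels of the form [1 / n].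
    Each claim then reduces to an inclusion between superlevel sets.  If
    [`|f + g|] is at least [e] at a point, then [`|f|] or [`|g|] is at least
    [e / 2] there.  A multiple of [g] by a scalar or by a bounded function is
    dominated by a constant times [`|g|], so its superlevel sets lie in
    superlevel sets of [g] at a lower level ([C0_dominated]).  If [g] is within
    [e / 2] of [f] uniformly, then [`|g|] is at least [e / 2] wherever [`|f|]
    is at least [e], which gives closedness.  Finally, every superlevel set of
    [f] at a positive level lies in [supp f]. *)

Section null_neighborhoods.
Context {X : topologicalType} {L I : set (set X)}.

Lemma has_null_neighborhoodS {A B : set X} :
  A `<=` B -> has_null_neighborhood I B -> has_null_neighborhood I A.
Proof. by move=> AB [U IU BU]; exists U => //; exact: subset_trans BU. Qed.

Lemma has_null_neighborhood0 :
  semilattice_ideal L I -> has_null_neighborhood I set0.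
Proof. by case=> -[U IU] _ _ _; exists U => //; exact: sub0set. Qed.

(** If [U] and [V] are null neighborhoods of [A] and [B], their join is null,
    and it contains [U] and [V], hence their interiors. *)
Lemma has_null_neighborhoodU {A B : set X} :
  upper_semilattice L -> semilattice_ideal L I ->
  has_null_neighborhood I A -> has_null_neighborhood I B ->
  has_null_neighborhood I (A `|` B).
Proof.
move=> hL [_ IL Ijoin _] [U IU AU] [V IV BV].
have [W UVW] := hL U V (IL _ IU) (IL _ IV).
exists W; first exact: Ijoin UVW.
have [_ UW VW _] := UVW.
by move=> x [/AU|/BV]; apply: interiorS.
Qed.

End null_neighborhoods.

Section vanishing_functions.
Context {R : realType} {X : topologicalType} {I : set (set X)}.

(** Levels can be arbitrary positive reals: some [1 / n] lies below each of
    them, and lowering the level enlarges the superlevel set. *)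
Lemma C0P {f : Cb X R} :
  C0 R I f <->
  forall e : R, 0 < e -> has_null_neighborhood I [set x | e <= `|f x|].
Proof.
split=> [f0 e e0|f0 n n0].
  have [n ne] : exists n, n.+1%:R^-1 < e.
    by exists (Num.truncn e^-1); rewrite invf_plt ?posrE// truncnS_gt.
  apply: has_null_neighborhoodS (f0 n.+1 isT) => x /= ex.
  by rewrite in_itv/= andbT (le_trans (ltW ne)).
apply: has_null_neighborhoodS (f0 n%:R^-1 _); last by rewrite invr_gt0 ltr0n.
by move=> x /=; rewrite in_itv/= andbT.
Qed.

(** Covers multiplication by scalars and by bounded functions at once, with [M]
    the absolute value of the scalar or the supremum norm of the factor. *)
Lemma C0_dominated (M : R) {f g : Cb X R} :
  0 <= M -> (forall x, `|f x| <= M * `|g x|) -> C0 R I g -> C0 R I f.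
Proof.
move=> M0 fg /C0P g0; apply/C0P => e e0.
(* [M + 1] rather than [M], since the level is divided by it. *)
have M1 : 0 < M + 1 by rewrite ltr_wpDl.
apply: has_null_neighborhoodS (g0 (e / (M + 1)) _); last exact: divr_gt0.
move=> x /= ex; rewrite ler_pdivrMr// mulrC.
by rewrite (le_trans ex)// (le_trans (fg x))// ler_wpM2r// lerDl.
Qed.

Lemma C0D {L : set (set X)} {f g : Cb X R} :
  upper_semilattice L -> semilattice_ideal L I ->
  C0 R I f -> C0 R I g -> C0 R I (f + g).
Proof.
move=> hL hI /C0P f0 /C0P g0; apply/C0P => e e0.
have e20 : 0 < e / 2 by rewrite divr_gt0.
apply: has_null_neighborhoodS
  (has_null_neighborhoodU hL hI (f0 _ e20) (g0 _ e20)) => x /= ex.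
have [fx|fx] := leP (e / 2) `|f x|; first by left.
right; rewrite /= leNgt; apply/negP => gx.
have := le_lt_trans (ler_normD _ _) (ltrD fx gx).
by rewrite -splitr ltNge ex.
Qed.

(** Approximating [f] within [e / 2] by some [g] in [C0 R I] suffices for the
    level [e], so no limit of neighborhoods is ever taken. *)
Lemma closed_C0 : closed (C0 R I).
Proof.
move=> f clf; apply/C0P => e e0.
have e20 : 0 < e / 2 by rewrite divr_gt0.
have [g [/C0P g0]] := clf _ (nbhsx_ballx f (e / 2) e20).
rewrite -ball_normE /= => fg.
apply: has_null_neighborhoodS (g0 _ e20) => x /= ex.
rewrite leNgt; apply/negP => gx.
have fgx : `|f x - g x| < e / 2 := le_lt_trans (supnorm_ge (f - g) x) fg.
have := le_lt_trans (ler_normD _ _) (ltrD fgx gx).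
by rewrite subrK -splitr ltNge ex.
Qed.

(** A null neighborhood of the support serves every positive level at once. *)
Lemma C00_subset_C0 : C00 R I `<=` C0 R I.
Proof.
move=> f f0; apply/C0P => e e0; apply: has_null_neighborhoodS f0.
move=> x /= ex; apply: subset_closure => /= fx0.
by move: ex; rewrite fx0 normr0 leNgt e0.
Qed.

End vanishing_functions.

Theorem theorem3p5 (R : realType) (X : topologicalType) (L I : set (set X))
    (hL : upper_semilattice L) (hI : semilattice_ideal L I) :
  (is_ideal (C0 R I) /\ closed (C0 R I)) /\ C00 R I `<=` C0 R I.
Proof.
split; [split; [split|exact: closed_C0]|exact: C00_subset_C0].
- apply/C0P => e e0; apply: has_null_neighborhoodS (has_null_neighborhood0 hI).
  by move=> x /=; rewrite normr0 leNgt e0.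
- by move=> f g; exact: C0D hL hI.
- move=> a f; apply: (C0_dominated `|a|) => // x.
  by rewrite -normrM.
- move=> f g; apply: (C0_dominated (supnorm f)) => [|x].
    exact: supnorm_ge0.
  by rewrite normrM ler_wpM2r// supnorm_ge.
Qed.
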